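(* Let $\mathbb{U}$ be a universe set, let $\mathcal{F}$ be an SVN-filter base on $\mathcal{SVN}(\mathbb{U})$, and let $$\langle \mathcal{F} \rangle = \left\{ \widetilde{A} \in \mathcal{SVN}(\mathbb{U}) : \ \exists\, \widetilde{F} \in \mathcal{F},\ \widetilde{F} \sqsubseteq \widetilde{A} \right\}$$ be the set of all neutrosophic supersets of members of $\mathcal{F}$. Then $\langle \mathcal{F} \rangle$ is an SVN-filter on $\mathcal{SVN}(\mathbb{U})$ containing $\mathcal{F}$, i.e. $\mathcal{F} \subseteq \langle \mathcal{F} \rangle$.
   Context: A single valued neutrosophic set (SVN-set) over a set $\mathbb{U}$ is a triple $\widetilde{A} = \langle \mu_A, \sigma_A, \omega_A \rangle$ of arbitrary functions $\mathbb{U} \to [0,1]$ (membership, indeterminacy, nonmembership). $\mathcal{SVN}(\mathbb{U})$ is the set of all SVN-sets over $\mathbb{U}$. Inclusion: $\widetilde{A} \sqsubseteq \widetilde{B}$ means $\mu_A(u) \le \mu_B(u)$, $\sigma_A(u) \le \sigma_B(u)$ and $\omega_A(u) \ge \omega_B(u)$ for every $u \in \mathbb{U}$. Two SVN-sets are equal if each is included in the other. Intersection: $\widetilde{A} \sqcap \widetilde{B} = \langle \min(\mu_A,\mu_B), \min(\sigma_A,\sigma_B), \max(\omega_A,\omega_B)\rangle$ (pointwise). The neutrosophic empty set is $\widetilde{\emptyset} = \langle 0,0,1\rangle$ (constant functions). A nonempty family $\mathcal{F} \subseteq \mathcal{SVN}(\mathbb{U})$ is an SVN-filter base on $\mathcal{SVN}(\mathbb{U})$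 if $\widetilde{\emptyset} \notin \mathcal{F}$ and for every $\widetilde{F}, \widetilde{G} \in \mathcal{F}$ there exists $\widetilde{H} \in \mathcal{F}$ with $\widetilde{H} \sqsubseteq \widetilde{F} \sqcap \widetilde{G}$. It is an SVN-filter if it is an SVN-filter base and for every $\widetilde{F} \in \mathcal{F}$ and every $\widetilde{A} \in \mathcal{SVN}(\mathbb{U})$ with $\widetilde{F} \sqsubseteq \widetilde{A}$ one has $\widetilde{A} \in \mathcal{F}$. *)

(* Defs.v *)
From mathcomp Require Import all_boot all_order all_algebra.
From mathcomp Require Import interval_inference all_classical all_reals.

Set Implicit Arguments.
Unset Strict Implicit.
Unset Printing Implicit Defensive.
Import Order.TTheory GRing.Theory Num.Theory.

Local Open Scope classical_set_scope.
Local Open Scope ring_scope.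

(* SVN-sets over U; {i01 R} is the unit interval [0, 1] of R with the order
   inherited from R. *)
Record svn_set (R : realType) (U : Type) := SVNSet {
  membership : U -> {i01 R} ;
  indeterminacy : U -> {i01 R} ;
  nonmembership : U -> {i01 R} }.

Definition svn_incl (R : realType) (U : Type) (A B : svn_set R U) : Prop :=
  forall u : U,
    [/\ membership A u <= membership B u,
        indeterminacy A u <= indeterminacy B u &
        nonmembership A u >= nonmembership B u].

Definition svn_inter (R : realType) (U : Type) (A B : svn_set R U) :
    svn_set R U :=
  {| membership := fun u => Num.min (membership A u) (membership B u) ;
     indeterminacy := fun u =>
       Num.min (indeterminacy A u) (indeterminacy B u) ;
     nonmembership := fun u =>
       Num.max (nonmembership A u) (nonmembership B u) |}.

Definition svn_empty (R : realType) (U : Type) : svn_set R U :=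
  {| membership := fun=> 0%:i01 ;
     indeterminacy := fun=> 0%:i01 ;
     nonmembership := fun=> 1%:i01 |}.

(* Mutual inclusion, the usual definition of equality of SVN-sets, is Leibniz
   equality, so that families of SVN-sets can be taken in set (svn_set R U). *)
Lemma svn_eqP (R : realType) (U : Type) (A B : svn_set R U) :
  A = B <-> svn_incl A B /\ svn_incl B A.
Proof.
split=> [->|]; first by split=> u; split; exact: lexx.
case: A B => [m s w] [m' s' w'] [AB BA].
congr SVNSet; apply/funext => u; have [/= ? ? ?] := AB u;
  have [/= ? ? ?] := BA u; by apply/le_anti/andP; split.
Qed.

Record svn_filter_base (R : realType) (U : Type) (F : set (svn_set R U)) :
    Prop := SVNFilterBase {
  svn_filter_base_nonempty : F !=set0 ;
  svn_filter_base_not_empty : ~ F (svn_empty R U) ;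
  svn_filter_base_inter : forall A B : svn_set R U, F A -> F B ->
    exists2 C : svn_set R U, F C & svn_incl C (svn_inter A B) }.

Record svn_filter (R : realType) (U : Type) (F : set (svn_set R U)) :
    Prop := SVNFilter {
  svn_filter_is_base : svn_filter_base F ;
  svn_filter_upward : forall A B : svn_set R U, F A -> svn_incl A B -> F B }.

Definition svn_supersets (R : realType) (U : Type) (F : set (svn_set R U)) :
    set (svn_set R U) :=
  [set A | exists2 B : svn_set R U, F B & svn_incl B A].

(* Main.v *)
(* Upward closure cannot create the empty SVN-set, since that set is the least
   element for inclusion, and intersection is monotone in both arguments. *)
Require Import Defs.
From mathcomp Require Import all_boot all_order all_algebra.
From mathcomp Require Import interval_inference all_classical all_reals.

Import Order.TTheory.

Local Open Scope classical_set_scope.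

(** Inclusion is a partial order with least element [svn_empty], and [svn_inter] is monotone for it.
    Hence every base property of [F] passes to the supersets: each is witnessed by members of [F]
    lying below. *)

Lemma svn_incl_refl (R : realType) (U : Type) (A : svn_set R U) :
  svn_incl A A.
Proof. by move=> u; split; exact: lexx. Qed.

Lemma svn_incl_trans (R : realType) (U : Type) (B A C : svn_set R U) :
  svn_incl A B -> svn_incl B C -> svn_incl A C.
Proof.
move=> AB BC u; have [mAB sAB wAB] := AB u; have [mBC sBC wBC] := BC u.
by split; [exact: le_trans mBC | exact: le_trans sBC | exact: le_trans wAB].
Qed.

(** [num_le] moves the comparisons to [R], where the bounds carried by [{i01 R}] settle them. *)
Lemma svn_empty_incl (R : realType) (U : Type) (A : svn_set R U) :
  svn_incl (svn_empty R U) A.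
Proof. by move=> u; split; rewrite -num_le /=. Qed.

Lemma svn_inter_mono (R : realType) (U : Type) (A A' B B' : svn_set R U) :
  svn_incl A A' -> svn_incl B B' ->
  svn_incl (svn_inter A B) (svn_inter A' B').
Proof.
move=> AA' BB' u; have [mA sA wA] := AA' u; have [mB sB wB] := BB' u.
by split=> /=; [exact: le_min2 | exact: le_min2 | exact: le_max2].
Qed.

Theorem proposition3p12 (R : realType) (U : Type) (F : set (svn_set R U)) :
  svn_filter_base F ->
  svn_filter (svn_supersets F) /\ F `<=` svn_supersets F.
Proof.
move=> [[A0 FA0] F0 FI].
have FS : F `<=` svn_supersets F.
  by move=> A FA; exists A => //; exact: svn_incl_refl.
split=> //; split; last first.
  by move=> A B [C FC CA] AB; exists C => //; exact: svn_incl_trans AB.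
split; first by exists A0; exact: FS.
- move=> [B FB B0]; apply: F0.
  (* By antisymmetry, a member of [F] below the empty set would be the empty set. *)
  by have <- : B = svn_empty R U by apply/svn_eqP; split=> //; exact: svn_empty_incl.
- move=> A B [A' FA' AA'] [B' FB' BB'].
  have [C FC CI] := FI _ _ FA' FB'.
  (* [C] lies below [svn_inter A' B'], hence below [svn_inter A B]. *)
  exists C; first exact: FS.
  exact: svn_incl_trans CI (svn_inter_mono _ _ _ _ _ _ AA' BB').
Qed.
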